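(* Let $M \subseteq \mathbb{R}^d$ be non-empty and closed and let $h(M) < \infty$. Then $\bar{h}(M) \le d+1$.
   Context: For a non-empty set $M \subseteq \mathbb{R}^d$, a subset $C \subseteq M$ is called $M$-convex if $C = M \cap K$ for some convex set $K \subseteq \mathbb{R}^d$ (the empty set is $M$-convex). Collections are indexed families. Helly number: $h(M)$ is the minimal integer $h \ge 0$ such that every finite collection $C_1,\ldots,C_m$ ($m \ge h$) of $M$-convex sets, for which every sub-collection of $h$ elements has non-empty intersection, satisfies $C_1 \cap \cdots \cap C_m \ne \emptyset$ (the intersection of the empty sub-collection is $M$); $h(M) := \infty$ if no such $h$ exists. Fractional Helly number: $\bar{h}(M)$ is the minimal positive integer $h$ such that for every $0 < \alpha \le 1$ there exists $0 < \beta = \beta(\alpha, M) \le 1$ such that every collection of $M$-convex sets $C_1,\ldots,C_n$ ($n \in \mathbb{N}$, $n \ge h$) satisfies: if $\bigcap_{i \in I} C_i \ne \emptyset$ for at least $\alpha \binom{n}{h}$ sets $I \subseteq \{1,\ldots,n\}$ of cardinality $h$, then at least $\beta n$ elements of $C_1,\ldots,C_n$ have a common point (i.e. there is a point belonging to $C_i$ for at least $\beta n$ indices $i$). If no such $h$ exists, $\bar{h}(M) := \infty$. *)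

(* Defs.v *)
From HB Require Import structures.
From mathcomp Require Import all_boot all_order all_algebra.
From mathcomp Require Import all_classical all_reals all_analysis.
Import Order.TTheory GRing.Theory Num.Theory.
Import numFieldNormedType.Exports.

Set Implicit Arguments.
Unset Strict Implicit.
Unset Printing Implicit Defensive.

Local Open Scope classical_set_scope.
Local Open Scope ring_scope.

Definition relatively_convex (R : realType) (d : nat) (M C : set 'rV[R]_d) :
  Prop := exists2 K : set 'rV[R]_d, convex_set K & C = M `&` K.

(* Intersecting with [M] makes the intersection of the empty subfamily [M]. *)
Definition subfamily_meet (R : realType) (d : nat) (M : set 'rV[R]_d)
    (n : nat) (C : 'I_n -> set 'rV[R]_d) (I : {set 'I_n}) : set 'rV[R]_d :=
  M `&` \bigcap_(i in [set` I]) C i.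

Definition least_or_infty (R : realType) (P : nat -> Prop) : \bar R :=
  match pselect (exists n, `[< P n >]) with
  | left exP => (ex_minn exP)%:R%:E
  | right _ => +oo%E
  end.

Definition helly_property (R : realType) (d : nat) (M : set 'rV[R]_d)
    (h : nat) : Prop :=
  forall (m : nat) (C : 'I_m -> set 'rV[R]_d),
    (h <= m)%N ->
    (forall i, relatively_convex M (C i)) ->
    (forall I : {set 'I_m}, #|I| = h -> subfamily_meet M C I !=set0) ->
    subfamily_meet M C [set: 'I_m]%SET !=set0.

Definition helly_number (R : realType) (d : nat) (M : set 'rV[R]_d) : \bar R :=
  least_or_infty R (helly_property M).

Definition fractional_helly_property (R : realType) (d : nat)
    (M : set 'rV[R]_d) (h : nat) : Prop :=
  forall alpha : R, 0 < alpha <= 1 ->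
  exists2 beta : R, 0 < beta <= 1 &
  forall (n : nat) (C : 'I_n -> set 'rV[R]_d),
    (h <= n)%N ->
    (forall i, relatively_convex M (C i)) ->
    alpha * 'C(n, h)%:R <=
      #|[pred I : {set 'I_n} |
          (#|I| == h) && `[< subfamily_meet M C I !=set0 >]]|%:R ->
    exists x : 'rV[R]_d, beta * n%:R <= #|[pred i : 'I_n | `[< C i x >]]|%:R.

Definition fractional_helly_number (R : realType) (d : nat)
    (M : set 'rV[R]_d) : \bar R :=
  least_or_infty R (fun h => (0 < h)%N /\ fractional_helly_property M h).

(* Main.v *)
Require Import Defs.
From mathcomp Require Import all_boot all_order all_algebra.
From mathcomp Require Import zify lra ring.
From mathcomp Require Import all_classical all_reals all_analysis.
Import Order.TTheory GRing.Theory Num.Theory.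
Import numFieldNormedType.Exports.

Set Implicit Arguments.
Unset Strict Implicit.
Unset Printing Implicit Defensive.

(* Write h for a Helly bound of M and r for d + 1.
   (1) If a positive fraction of all h-tuples of the sets meet in M, then some
   point of M lies in a positive fraction of the sets: by Helly's property the
   lexicographic minimum of an h-wise intersection is already the minimum of
   the intersection of h - 1 of the h sets, and one averages over these.
   (2) A large r-partite family in which every rainbow r-tuple meets in M
   contains h sets of one colour that meet in M. Otherwise, h sets of one
   colour lie in h halfspaces (in a suitable order, with repetitions) that have
   no common point of M. The chosen point of a rainbow tuple through one of the
   sets thus misses one of these halfspaces; after shrinking the other colours,
   which halfspace is missed depends only on the set, so that two of the h sets
   become strictly separated by a hyperplane. Doing this for all h-subsets of a
   large colour class, Ramsey's theorem gives many pairwise separated sets, and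
   then one treats the next colour. In the end each colour keeps two sets
   separated by a hyperplane; the chosen points realize all sign patterns of
   d + 1 affine functions on a d-dimensional space, which is impossible.
   (3) If a positive fraction of the r-tuples meet, then by the power mean
   inequality so does a positive fraction of the r-partite families of (2);
   so h-tuples that meet cannot be too rare, and (1) applies. *)

(** * Homogeneous subgrids *)

Section Subgrids.
Variables J I : finType.
Implicit Types (S : J -> {set I}) (b : {ffun J -> I}).

Definition update (X : Type) (b : {ffun J -> X}) j x : {ffun J -> X} :=
  [ffun i => if i == j then x else b i].

Definition in_grid S b := [forall i, b i \in S i].

Definition subgrid S' S := forall i, S' i \subset S i.

Definition large k S := forall i, k <= #|S i|.

Lemma subgrid_trans S2 S1 S3 : subgrid S1 S2 -> subgrid S2 S3 -> subgrid S1 S3.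
Proof. by move=> s12 s23 i; apply: fintype.subset_trans (s12 i) (s23 i). Qed.

Lemma in_gridS S' S b : subgrid S' S -> in_grid S' b -> in_grid S b.
Proof. by move=> sS /forallP bS; apply/forallP => i; apply: (fintype.subsetP (sS i)). Qed.

(** The indices of [J] are treated one after another, each at the cost of one application of [N];
    heredity under subgrids preserves what was achieved before. *)
Lemma shrink_all (N : nat -> nat) (Phi : J -> (J -> {set I}) -> Prop) :
  (forall j S S', subgrid S' S -> Phi j S -> Phi j S') ->
  (forall j k S, large (N k) S ->
     exists S', [/\ subgrid S' S, large k S' & Phi j S']) ->
  forall k S, large (iter #|J| N k) S ->
    exists S', [/\ subgrid S' S, large k S' & forall j, Phi j S'].
Proof.
move=> mono step k S lS.
suff [S' [sS' lS' PS']] : exists S', [/\ subgrid S' S, large k S'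
    & forall j, j \in enum J -> Phi j S'].
  by exists S'; split=> // j; apply: PS'; rewrite mem_enum.
move: lS; rewrite cardE; elim: (enum J) S => [|j s IHs] S lS.
  by exists S; split.
have [S1 [sS1 lS1 P1]] := step j _ _ lS.
have [S2 [sS2 lS2 P2]] := IHs _ lS1.
exists S2; split=> //; first exact: subgrid_trans sS2 sS1.
move=> i; rewrite inE => /orP[/eqP ->|/P2 //]; exact: (mono _ _ _ sS2 P1).
Qed.

End Subgrids.

(** * Pigeonhole principles *)

Lemma subset_of_card (I : finType) (S : {set I}) m : m <= #|S| ->
  exists2 S' : {set I}, S' \subset S & #|S'| = m.
Proof.
elim: m => [|m IHm] mS; first by exists finset.set0; rewrite ?finset.sub0set ?cards0.
have [S' sS' cS'] := IHm (ltnW mS).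
have /fintype.subsetPn[x xS xS'] : ~~ (S \subset S').
  by apply/negP => /subset_leq_card; rewrite cS' leqNgt mS.
exists (x |: S')%SET; last by rewrite cardsU1 xS' cS'.
by rewrite finset.subUset finset.sub1set xS.
Qed.

Lemma pigeonhole_set (I Q : finType) (f : I -> Q) m (S : {set I}) :
  m * #|Q|.+1 <= #|S| -> exists S' : {set I},
    [/\ S' \subset S, m <= #|S'| & {in S' &, forall x y, f x = f y}].
Proof.
move=> mS; have [|] := boolP [exists q, m <= #|[set x in S | f x == q]%SET|].
  move=> /existsP[q mq]; exists [set x in S | f x == q]%SET; split=> //.
    by apply/fintype.subsetP => x; rewrite inE => /andP[].
  by move=> x y; rewrite !inE => /andP[_ /eqP ->] /andP[_ /eqP ->].
rewrite negb_exists => /forallP small.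
(* Fibres smaller than [m] give [#|S| <= m * #|Q|], against the hypothesis unless [m = 0]. *)
have m0 : m = 0.
  apply/eqP; rewrite -leqn0 leqNgt; apply/negP => m0.
  suff : #|S| <= m * #|Q| by apply/negP; rewrite -ltnNge (leq_trans _ mS) ?ltn_pmul2l.
  rewrite -sum1_card (partition_big f predT) //= mulnC -sum_nat_const.
  apply: leq_sum => q _; have := small q; rewrite -ltnNge => /ltnW.
  by apply: leq_trans; rewrite -sum1_card; apply/eq_leq/eq_bigl => x; rewrite inE.
by exists finset.set0; split; rewrite ?m0 ?finset.sub0set // => x y; rewrite inE.
Qed.

Lemma pigeonhole_family (I Q : finType) (T : eqType) (f : T -> I -> Q) m
    (s : seq T) (S : {set I}) :
  m * #|Q|.+1 ^ size s <= #|S| -> exists S' : {set I},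
    [/\ S' \subset S, m <= #|S'| &
       forall t, t \in s -> {in S' &, forall x y, f t x = f t y}].
Proof.
elim: s S => [|t s IHs] S /=; first by rewrite expn0 muln1 => mS; exists S.
rewrite expnSr mulnA => /(pigeonhole_set (f t))[S1 [sS1 /IHs[S2 [sS2 mS2 cS2]] cS1]].
exists S2; split=> //; first exact: fintype.subset_trans sS1.
move=> u; rewrite inE => /orP[/eqP ->|/cS2//] x y xS yS.
by apply: cS1; apply: (fintype.subsetP sS2).
Qed.

Section GridPigeonhole.
Variables J I Q : finType.
Variable chi : {ffun J -> I} -> Q.

(** With the other coordinates trimmed to [k] values each, there are at most [k ^ r] settings of
    them, and each costs one factor [q.+1]. *)
Definition grid_pigeonhole_size q r k := k * q.+1 ^ (k ^ r).

Definition indep_of j (S : J -> {set I}) := forall b b',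
  in_grid S b -> in_grid S b' -> (forall i, i != j -> b i = b' i) -> chi b = chi b'.

Lemma indep_ofS j S S' : subgrid S' S -> indep_of j S -> indep_of j S'.
Proof. by move=> sS iS b b' bS b'S; apply: iS; apply: in_gridS sS _. Qed.

Lemma grid_pigeonhole_step j k S : large (grid_pigeonhole_size #|Q| #|J| k) S ->
  exists S', [/\ subgrid S' S, large k S' & indep_of j S'].
Proof.
have [->|k0] := posnP k.
  move=> _; exists (fun=> finset.set0); split=> [i||b b' /forallP/(_ j)] //.
  - exact: finset.sub0set.
  - by rewrite inE.
move=> lS.
have kS i : k <= #|S i|.
  by apply: leq_trans (lS i); rewrite leq_pmulr // expn_gt0.
have [T sT cT] : exists2 T : J -> {set I}, subgrid T S & forall i, #|T i| = k.
  have /fin_all_exists2[T sT cT] : forall i, exists2 T : {set I}, T \subset S i & #|T| = k.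
    by move=> i; apply: subset_of_card.
  by exists T.
have [x0 x0S] : exists x, x \in S j by apply/card_gt0P/(leq_trans k0).
(* Freezing coordinate [j] at [x0] makes [s] list every setting of the other coordinates once. *)
pose F i := if i == j then pred1 x0 else mem (T i).
pose s := enum (family F).
have [] := @pigeonhole_family _ _ _ (fun b x => chi (update b j x)) k s (S j).
  apply: leq_trans (lS j); rewrite leq_pmul2l // leq_pexp2l // -cardE card_family.
  rewrite /image_mem cardT; elim: (enum J) => //= i l IHl; rewrite expnS leq_mul //.
  by rewrite /F; case: eqP => _; rewrite ?card1 ?cT.
move=> S' [sS' kS' cS'].
exists (fun i => if i == j then S' else T i); split.
- by move=> i; case: eqP => [->|_].
- by move=> i; case: eqP => _; rewrite ?cT.
move=> b b' /forallP bS /forallP b'S ebb'.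
pose g := update b j x0.
have gs : g \in s.
  rewrite mem_enum; apply/familyP => i; rewrite /F ffunE.
  by have := bS i; case: eqP => _; rewrite // inE.
have -> : b = update g j (b j) by apply/ffunP => i; rewrite !ffunE; case: eqP => [->|].
have -> : b' = update g j (b' j).
  by apply/ffunP => i; rewrite !ffunE; case: eqP => [->|/eqP/ebb'].
by apply: cS' => //; [have := bS j|have := b'S j]; rewrite eqxx.
Qed.

Lemma grid_pigeonhole k S :
  large (iter #|J| (grid_pigeonhole_size #|Q| #|J|) k) S ->
  exists S', [/\ subgrid S' S, large k S' &
    forall b b', in_grid S' b -> in_grid S' b' -> chi b = chi b'].
Proof.
move=> /(shrink_all indep_ofS (fun j k S => @grid_pigeonhole_step j k S)).
case=> S' [sS' kS' iS']; exists S'; split=> // b b' bS b'S.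
(* The hybrids lead from [b] to [b'], changing at most one coordinate at a time. *)
pose hyb (s : seq J) := [ffun i => if i \in s then b' i else b i].
have hybS s : in_grid S' (hyb s).
  apply/forallP => i; rewrite ffunE; case: ifP => _.
    exact: (forallP b'S).
  exact: (forallP bS).
suff : chi (hyb [::]) = chi (hyb (enum J)).
  have -> : hyb [::] = b by apply/ffunP => i; rewrite ffunE.
  have -> // : hyb (enum J) = b' by apply/ffunP => i; rewrite ffunE mem_enum.
elim: (enum J) => // j s ->; apply: (iS' j) => // i /negbTE ij.
by rewrite !ffunE inE ij.
Qed.

End GridPigeonhole.

(** Induction on [k + l]: a vertex [v] has at least [2 ^ (k + l - 1)] neighbours or as many
    non-neighbours in [X]; it extends a clique among the former or an independent set among the
    latter. *)
Lemma ramsey (T : finType) (e : rel T) (k l : nat) (X : {set T}) :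
  symmetric e -> 2 ^ (k + l) <= #|X| ->
  (exists2 Y : {set T}, Y \subset X /\ #|Y| = k &
     {in Y &, forall x y, x != y -> e x y}) \/
  (exists2 Y : {set T}, Y \subset X /\ #|Y| = l &
     {in Y &, forall x y, x != y -> ~~ e x y}).
Proof.
move=> sym_e; move: {2}(k + l) (erefl (k + l)) => n; elim: n k l X => [|n IHn] k l X.
  move=> /eqP; rewrite addn_eq0 => /andP[/eqP -> /eqP ->] _; left.
  by exists finset.set0; rewrite ?cards0 ?finset.sub0set // => x; rewrite inE.
case: k => [|k].
  by left; exists finset.set0; rewrite ?cards0 ?finset.sub0set // => x; rewrite inE.
case: l => [|l].
  by right; exists finset.set0; rewrite ?cards0 ?finset.sub0set // => x; rewrite inE.
move=> kln big.
have /card_gt0P[v vX] : 0 < #|X| by apply: leq_trans big; rewrite expn_gt0.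
pose A := [set x in X | (x != v) && e v x]%SET.
pose B := [set x in X | (x != v) && ~~ e v x]%SET.
have cX : #|X| = (#|A| + #|B|).+1.
  rewrite (cardsD1 v) vX add1n; congr _.+1.
  rewrite -(cardsID [set x | e v x]%SET (X :\ v)%SET); congr (_ + _).
    by apply: eq_card => x; rewrite !inE; case: (x \in X); rewrite ?andbF ?andbT.
  by apply: eq_card => x; rewrite !inE; case: (x \in X); rewrite ?andbF ?andbT // andbC.
have AX : A \subset X by apply/fintype.subsetP => x; rewrite inE => /andP[].
have BX : B \subset X by apply/fintype.subsetP => x; rewrite inE => /andP[].
have vA : v \notin A by rewrite !inE eqxx !andbF.
have vB : v \notin B by rewrite !inE eqxx !andbF.
have [bA|sA] := leqP (2 ^ n) #|A|.
  have en : k + l.+1 = n by case: kln.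
  case: (IHn k l.+1 A en); rewrite ?en //; last first.
    by case=> Y [sY cY] iY; right; exists Y => //; split=> //; apply: fintype.subset_trans AX.
  case=> Y [sY cY] iY; left; exists (v |: Y)%SET.
    split; first by rewrite finset.subUset finset.sub1set vX (fintype.subset_trans sY AX).
    by rewrite cardsU1 cY (contra (fintype.subsetP sY v) vA).
  move=> x y; rewrite !inE => /orP[/eqP ->|xY] /orP[/eqP ->|yY]; rewrite ?eqxx //.
  - by move=> _; have := fintype.subsetP sY _ yY; rewrite !inE => /and3P[].
  - by move=> _; have := fintype.subsetP sY _ xY; rewrite !inE sym_e => /and3P[].
  - exact: iY.
have bB : 2 ^ n <= #|B|.
  rewrite leqNgt; apply/negP => sB; move: big; rewrite kln cX leqNgt; apply/negP.
  rewrite negbK expnS mul2n -addnn -addnS; apply: (@leq_trans (#|A|.+1 + #|B|.+1)).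
    by rewrite addSn.
  exact: leq_add.
have en : k.+1 + l = n by case: kln => <-; rewrite addSnnS.
case: (IHn k.+1 l B en); rewrite ?en //.
  by case=> Y [sY cY] iY; left; exists Y => //; split=> //; apply: fintype.subset_trans BX.
case=> Y [sY cY] iY; right; exists (v |: Y)%SET.
  split; first by rewrite finset.subUset finset.sub1set vX (fintype.subset_trans sY BX).
  by rewrite cardsU1 cY (contra (fintype.subsetP sY v) vB).
move=> x y; rewrite !inE => /orP[/eqP ->|xY] /orP[/eqP ->|yY]; rewrite ?eqxx //.
- by move=> _; have := fintype.subsetP sY _ yY; rewrite !inE => /and3P[].
- by move=> _; have := fintype.subsetP sY _ xY; rewrite !inE sym_e => /and3P[].
- exact: iY.
Qed.

(** * Blow-ups *)

(* [get] and [put] form a lens, so (w, g) |-> (put w g, get w) is an involution. *)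
Lemma sum_put (W G : finType) (get : W -> G) (put : W -> G -> W) (F : W -> nat) :
  (forall w g, get (put w g) = g) -> (forall w, put w (get w) = w) ->
  (forall w g g', put (put w g) g' = put w g') ->
  #|G| * \sum_w F w = \sum_w \sum_g F (put w g).
Proof.
move=> getK putK putput; rewrite pair_big /=.
pose swap (x : W * G) := (put x.1 x.2, get x.1).
have swapK : involutive swap by case=> w g; rewrite /swap /= putput putK getK.
rewrite (reindex_inj (inv_inj swapK)) /=.
rewrite -(pair_big predT predT (fun w g => F (put (put w g) (get w)))) /=.
rewrite big_distrr /=; apply: eq_bigr => w _.
rewrite (eq_bigr (fun=> F w)) ?sum_nat_const // => g _.
by rewrite putput putK.
Qed.

Lemma rearrange_expn a b s : a * b ^ s + b * a ^ s <= a ^ s.+1 + b ^ s.+1.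
Proof.
wlog ab : a b / a <= b.
  move=> H; have [/H //|/ltnW/H] := leqP a b.
  by rewrite [leqLHS]addnC [leqRHS]addnC.
have [c ->] : exists c, b = a + c by exists (b - a); rewrite subnKC.
have ac : a ^ s <= (a + c) ^ s by case: s => // s; rewrite leq_exp2r ?leq_addr.
rewrite !expnS -(subnKC ac) !mulnDl !mulnDr; lia.
Qed.

(** The power mean inequality, by iterating Chebyshev's sum inequality for the similarly ordered [a]
    and [a ^ s]. *)
Lemma sum_expn_le (W : finType) (a : W -> nat) t :
  (\sum_w a w) ^ t.+1 <= #|W| ^ t * \sum_w a w ^ t.+1.
Proof.
have chebyshev s :
    (\sum_w a w) * (\sum_w a w ^ s) <= #|W| * \sum_w a w ^ s.+1.
  (* Doubling symmetrizes both sides into sums over pairs [(w, v)], which compare pair by pair. *)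
  rewrite -(@leq_pmul2l 2) // !mul2n -!addnn.
  have dbl (F G : W -> nat) : (\sum_w F w) * (\sum_w G w) = \sum_w \sum_v F w * G v.
    by rewrite big_distrl; apply: eq_bigr => w _; rewrite big_distrr.
  have cst (F : W -> nat) : #|W| * \sum_w F w = \sum_w \sum_(v : W) F w.
    by rewrite big_distrr; apply: eq_bigr => w _; rewrite sum_nat_const.
  have cst' (F : W -> nat) : #|W| * \sum_w F w = \sum_(w : W) \sum_v F v.
    by rewrite sum_nat_const.
  rewrite {2}[(\sum_w a w) * _]mulnC !dbl {1}cst cst' -!big_split /=.
  apply: leq_sum => w _; rewrite -!big_split /=; apply: leq_sum => v _.
  by rewrite [a w ^ s * _]mulnC rearrange_expn.
elim: t => [|t IHt]; first by rewrite expn1 mul1n; apply: leq_sum => w _; rewrite expn1.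
rewrite expnS (leq_trans (leq_mul (leqnn _) IHt)) //.
by rewrite mulnCA [#|W| ^ t.+1]expnSr -mulnA leq_mul.
Qed.

Section Blowup.
Variables (J X : finType) (t' : nat) (F : pred {ffun J -> X}).
Let t := t'.+1.
Let T := {ffun 'I_t -> X}.
Let W := {ffun J -> T}.

(** [w] gives every colour [j] a list of [t] points, possibly repeated; [b] picks one of them per
    colour. *)
Definition select (w : {ffun J -> {ffun 'I_t -> X}}) (b : {ffun J -> 'I_t}) :
  {ffun J -> X} := [ffun j => w j (b j)].

(* The coordinates outside [L] are frozen at [ord0]: [blown] interpolates between
   [F] and its full blow-up, one coordinate at a time. *)
Definition blown (L : seq J) (w : {ffun J -> {ffun 'I_t -> X}}) :=
  [forall b : {ffun J -> 'I_t},
     [forall j, (j \notin L) ==> (b j == ord0)] ==> F (select w b)].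

Lemma blown_nil : (#|X| ^ #|J| * \sum_(w : W) blown [::] w =
  #|{: W}| * #|F|)%N.
Proof.
pose get (w : W) : {ffun J -> X} := [ffun j => w j ord0].
pose put (w : W) (g : {ffun J -> X}) : W := [ffun j => update (w j) ord0 (g j)].
rewrite -card_ffun (@sum_put _ _ get put) //=.
- rewrite -sum_nat_const; apply: eq_bigr => w _; rewrite -sum1_card big_mkcond /=.
  rewrite [RHS]big_mkcond /=; apply: eq_bigr => g _.
  suff -> : blown [::] (put w g) = F g by have -> : (g \in F) = F g by []; case: (F g).
  apply/forallP/idP => [/(_ [ffun=> ord0])|Fg b].
    have -> : select (put w g) [ffun=> ord0] = g by apply/ffunP => j; rewrite !ffunE eqxx.
    by move/implyP; apply; apply/forallP => j; rewrite ffunE eqxx.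
  apply/implyP => /forallP b0; suff -> : select (put w g) b = g by [].
  by apply/ffunP => j; rewrite !ffunE (implyP (b0 j)).
- by move=> w g; apply/ffunP => j; rewrite !ffunE eqxx.
- by move=> w; apply/ffunP => j; apply/ffunP => i; rewrite !ffunE; case: eqP => [->|].
- by move=> w g g'; apply/ffunP => j; apply/ffunP => i; rewrite !ffunE; case: eqP.
Qed.

(** With the other colours fixed, [a w] points are admissible at [j]. A frozen [j] tests one entry,
    an unfrozen one tests [t] independent entries, so the two sums average [a w] and [a w ^ t]; the
    power mean inequality compares them. *)
Lemma blown_step j L : j \notin L ->
  ((\sum_(w : W) blown L w) ^ t <= #|{: W}| ^ t' * \sum_(w : W) blown (j :: L) w)%N.
Proof.
move=> jL.
have [X0|X0] := posnP #|X|.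
  rewrite big1 ?exp0n // => w _; suff: false by [].
  by have := card0_eq X0 (w j ord0).
pose g (w : W) x := blown L (update w j [ffun=> x]).
pose a w := \sum_x g w x.
have blownL w : blown L w = g w (w j ord0).
  apply: eq_forallb => b; apply: implyb_id2l => /forallP b0; congr (F _).
  apply/ffunP => i; rewrite !ffunE; case: eqP => [->|//]; rewrite ffunE.
  by rewrite (eqP (implyP (b0 j) jL)).
have g_update w tau x : g (update w j tau) x = g w x.
  by congr (blown L _); apply/ffunP => i; rewrite !ffunE; case: eqP.
have blownjL w : blown (j :: L) w = [forall i, g w (w j i)].
  apply/forallP/forallP => [H i|H b].
    apply/forallP => b; apply/implyP => /forallP b0.
    have := H (update b j i).
    have -> : select w (update b j i) = select (update w j [ffun=> w j i]) b.
      by apply/ffunP => k; rewrite !ffunE; case: eqP => [->|//]; rewrite ffunE.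
    move/implyP; apply; apply/forallP => k; apply/implyP; rewrite inE negb_or ffunE.
    by case/andP => /negbTE -> ; apply/implyP.
  apply/implyP => /forallP b0.
  have /forallP/(_ (update b j ord0)) := H (b j).
  have -> : select (update w j [ffun=> w j (b j)]) (update b j ord0) = select w b.
    by apply/ffunP => k; rewrite !ffunE; case: eqP => [->|//]; rewrite ffunE.
  move/implyP; apply; apply/forallP => k; apply/implyP => kL; rewrite ffunE.
  by case: (eqVneq k j) => // kj; apply: (implyP (b0 k)); rewrite inE negb_or kj.
have laws : [/\ forall (w : W) tau, update w j tau j = tau,
    forall w : W, update w j (w j) = w &
    forall (w : W) tau tau', update (update w j tau) j tau' = update w j tau'].
  split=> [w tau|w|w tau tau']; first by rewrite ffunE eqxx.
    by apply/ffunP => i; rewrite !ffunE; case: eqP => [->|].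
  by apply/ffunP => i; rewrite !ffunE; case: eqP.
case: laws => getK putK putput.
have cT : #|{: T}| = (#|X| ^ t)%N by rewrite card_ffun card_ord.
have sumL : #|X| * \sum_w blown L w = \sum_w a w.
  apply/eqP; rewrite -(@eqn_pmul2l #|{: T}|); last by rewrite cT expn_gt0 X0.
  rewrite mulnCA (@sum_put _ _ (fun w : W => w j) (fun w => update w j)) //.
  rewrite !big_distrr /=; apply/eqP/eq_bigr => w _.
  under eq_bigr do rewrite blownL g_update getK.
  rewrite (@sum_put _ _ (fun tau : T => tau ord0) (fun tau x => update tau ord0 x)
    (fun tau : T => g w (tau ord0) : nat)).
  - rewrite -sum_nat_const; apply: eq_bigr => tau _; apply: eq_bigr => x _.
    by rewrite ffunE eqxx.
  - by move=> tau x; rewrite ffunE eqxx.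
  - by move=> tau; apply/ffunP => i; rewrite !ffunE; case: eqP => [->|].
  - by move=> tau x x'; apply/ffunP => i; rewrite !ffunE; case: eqP.
have sumjL : #|{: T}| * \sum_w blown (j :: L) w = \sum_w a w ^ t.
  rewrite (@sum_put _ _ (fun w : W => w j) (fun w => update w j)) //.
  apply: eq_bigr => w _.
  under eq_bigr => tau _.
    rewrite blownjL getK.
    under eq_forallb do rewrite g_update.
    over.
  have -> : a w ^ t = \prod_(i < t) \sum_x g w x by rewrite prod_nat_const card_ord.
  rewrite bigA_distr_bigA /=; apply: eq_bigr => tau _.
  have [/forallP all_g|/forallPn[i /negbTE ng]] := boolP [forall i, g w (tau i)].
    by rewrite big1 // => i _; rewrite all_g.
  by rewrite (bigD1 i) //= ng mul0n.
have := sum_expn_le a t'; rewrite -sumL -sumjL -/t cT expnMn.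
by rewrite [leqRHS]mulnCA leq_pmul2l // expn_gt0 X0.
Qed.

Lemma select_blown (w : W) b : blown (enum J) w -> F (select w b).
Proof.
move=> /forallP/(_ b)/implyP; apply.
by apply/forallP => j; rewrite mem_enum.
Qed.

(** Each of the [#|J|] unfreezings raises the density to the power [t] at worst. *)
Lemma blown_density (R : realFieldType) : (0 < #|X|)%N ->
  ((#|F|%:R / (#|X| ^ #|J|)%:R) ^+ (t ^ #|J|) * #|{: W}|%:R <=
   (\sum_(w : W) blown (enum J) w)%:R :> R)%R.
Proof.
move=> X0.
have cW0 : (0 < #|{: W}|)%N by rewrite !card_ffun !expn_gt0 X0.
pose dens L : R := ((\sum_(w : W) blown L w)%:R / #|{: W}|%:R)%R.
have W0 : (0 < #|{: W}|%:R :> R)%R by rewrite ltr0n.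
have dens0 : dens [::] = (#|F|%:R / (#|X| ^ #|J|)%:R)%R.
  apply/eqP; rewrite eqr_div ?pnatr_eq0 -?lt0n ?expn_gt0 ?X0 //.
  by rewrite -!natrM mulnC blown_nil mulnC.
have step j L : j \notin L -> (dens L ^+ t <= dens (j :: L))%R.
  move=> /blown_step H; rewrite expr_div_n ler_pdivrMr ?exprn_gt0 //.
  rewrite [X in (_ * X)%R]exprS mulrA divfK ?lt0r_neq0 // mulrC.
  by rewrite -!natrX -natrM ler_nat.
rewrite -ler_pdivlMr // -/(dens _) -dens0.
have : uniq (enum J) by rewrite enum_uniq.
rewrite cardE; elim: (enum J) => [|j s IHs] //= /andP[js us].
rewrite expnSr exprM; apply: le_trans (step _ _ js).
by rewrite lerXn2r ?nnegrE ?exprn_ge0 ?divr_ge0 ?ler0n // IHs.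
Qed.

End Blowup.

(** First moment method: for injective [Y] the entries at [Y] are independent, so they land in [H]
    for a fraction [#|H| / #|X| ^ h] of all [w]. Summed over the at most [#|J| * t'.+1 ^ h] pairs
    [(j, Y)], this is less than the density of blow-ups inside [F]. *)
Lemma exists_blowup (R : realFieldType) (J X : finType) (t' h : nat)
    (F : pred {ffun J -> X}) (H : pred {ffun 'I_h -> X}) (alpha : R) :
  (0 < #|X|)%N -> (0 <= alpha ->
   alpha * (#|X| ^ #|J|)%:R <= #|F|%:R ->
   #|H|%:R * (#|J| * t'.+1 ^ h)%:R < alpha ^+ (t'.+1 ^ #|J|) * (#|X| ^ h)%:R ->
  exists w : {ffun J -> {ffun 'I_t'.+1 -> X}}, (forall b, F (select w b)) /\
    forall j (Y : {ffun 'I_h -> 'I_t'.+1}), injective Y ->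
      ~~ H [ffun s => w j (Y s)])%R.
Proof.
move=> X0 alpha0 denseF sparseH.
pose W := {ffun J -> {ffun 'I_t'.+1 -> X}}.
have cW0 : (0 < #|{: W}|)%N by rewrite !card_ffun !expn_gt0 X0.
pose bad (w : W) := \sum_j \sum_(Y : {ffun 'I_h -> 'I_t'.+1} | injectiveb Y)
  H [ffun s => w j (Y s)].
suff : (\sum_w bad w < \sum_(w : W) blown F (enum J) w)%N.
  have [/existsP[w /andP[bw /eqP bad0]] _|] :=
      boolP [exists w : W, blown F (enum J) w && (bad w == 0)].
    exists w; split=> [b|j Y injY]; first exact: select_blown.
    move/eqP: bad0; rewrite sum_nat_eq0 => /forallP/(_ j).
    by rewrite sum_nat_eq0 => /forallP/(_ Y)/implyP/(_ (introT (injectiveP _) injY)); case: (H _).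
  rewrite negb_exists => /forallP nw; rewrite ltnNge => /negP; case.
  apply: leq_sum => w _; have := nw w; rewrite negb_and -lt0n.
  by case: (blown _ _ _).
rewrite -(ltr_nat R); have := blown_density t' F R X0.
apply: lt_le_trans.
have : (\sum_w bad w) * #|X| ^ h <= #|J| * t'.+1 ^ h * (#|{: W}| * #|H|).
  rewrite exchange_big /= big_distrl /= -mulnA -sum_nat_const.
  apply: leq_sum => j _; rewrite exchange_big /=.
  apply: (@leq_trans (\sum_(Y : {ffun 'I_h -> 'I_t'.+1} | injectiveb Y) #|{: W}| * #|H|)).
    rewrite big_distrl; apply: leq_sum => Y /injectiveP injY.
    pose put (w : W) (g : {ffun 'I_h -> X}) : W := update w j
      [ffun i => if [pick s | Y s == i] is Some s then g s else w j i].
    have pickY s : [pick s' | Y s' == Y s] = Some s.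
      by case: pickP => [s' /eqP/injY ->|/(_ s)] //; rewrite eqxx.
    have <- : #|{ffun 'I_h -> X}| = #|X| ^ h by rewrite card_ffun card_ord.
    rewrite /= mulnC (@sum_put _ _ (fun w : W => [ffun s => w j (Y s)]) put
      (fun w => H [ffun s => w j (Y s)])).
    - rewrite -sum_nat_const; apply: leq_sum => w _; rewrite -sum1_card big_mkcond.
      rewrite [leqRHS]big_mkcond; apply: leq_sum => g _ /=.
      rewrite (_ : [ffun s => put w g j (Y s)] = g); last first.
        by apply/ffunP => s; rewrite !ffunE eqxx ffunE pickY.
      by have -> : (g \in H) = H g by []; case: (H g).
    - by move=> w g; apply/ffunP => s; rewrite !ffunE eqxx ffunE pickY.
    - move=> w; apply/ffunP => i; rewrite !ffunE; case: eqP => [->|//].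
      by apply/ffunP => s; rewrite ffunE; case: pickP => // s' /eqP <-; rewrite ffunE.
    - move=> w g g'; apply/ffunP => i; rewrite !ffunE; case: eqP => [_|//].
      by apply/ffunP => s; rewrite !ffunE eqxx ffunE; case: pickP.
  rewrite sum_nat_const leq_mul2r; apply/orP; right.
  by apply: leq_trans (max_card _) _; rewrite card_ffun !card_ord.
move=> le_bad; have Xh : (0 < (#|X| ^ h)%:R :> R)%R by rewrite ltr0n expn_gt0 X0.
rewrite -(ltr_pM2r Xh) -natrM.
apply: (@le_lt_trans _ _ (#|H|%:R * (#|J| * t'.+1 ^ h)%:R * #|{: W}|%:R)%R).
  by rewrite -!natrM ler_nat (leq_trans le_bad) // mulnA [leqRHS]mulnAC [leqRHS]mulnC mulnA; lia.
rewrite [ltRHS]mulrAC ltr_pM2r ?ltr0n //; apply: lt_le_trans sparseH _.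
rewrite ler_pM2r // lerXn2r ?nnegrE //.
  by rewrite ler_pdivlMr // ltr0n expn_gt0 X0.
Qed.

Local Open Scope classical_set_scope.
Local Open Scope ring_scope.

(** * Halfspaces and convex hulls *)

Section ConvexGeometry.
Variables (R : realType) (d : nat).
Implicit Types (u v w x y : 'rV[R]_d) (K P : set 'rV[R]_d).

Definition dot u x : R := \sum_k u 0 k * x 0 k.

Lemma dotDr u x y : dot u (x + y) = dot u x + dot u y.
Proof. by rewrite -big_split; apply: eq_bigr => k _; rewrite mxE mulrDr. Qed.

Lemma dotZr u a x : dot u (a *: x) = a * dot u x.
Proof. by rewrite mulr_sumr; apply: eq_bigr => k _; rewrite mxE mulrCA. Qed.

Lemma dotC u x : dot u x = dot x u.
Proof. by apply: eq_bigr => k _; rewrite mulrC. Qed.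

Lemma dotNr u x : dot u (- x) = - dot u x.
Proof. by rewrite -scaleN1r dotZr mulN1r. Qed.

Lemma dot0r u : dot u 0 = 0.
Proof. by rewrite -[0 : 'rV__](scale0r 0) dotZr mul0r. Qed.

Lemma dotNl u x : dot (- u) x = - dot u x.
Proof. by rewrite dotC dotNr dotC. Qed.

Lemma dot_ge0 u : 0 <= dot u u.
Proof. by apply: sumr_ge0 => k _; rewrite -expr2 sqr_ge0. Qed.

Lemma dot_eq0 u : dot u u <= 0 -> u = 0.
Proof.
move=> u0; apply/rowP => k; rewrite mxE; apply/eqP; rewrite -sqrf_eq0 expr2.
have /eqP : dot u u = 0 by apply/le_anti; rewrite u0 dot_ge0.
rewrite psumr_eq0 => [/allP/(_ k)|i _]; last by rewrite -expr2 sqr_ge0.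
by rewrite mem_index_enum => /(_ isT).
Qed.

Lemma continuous_sum (T : topologicalType) (I : Type) (r : seq I) (f : I -> T -> R) :
  (forall i, continuous (f i)) -> continuous (fun z => \sum_(i <- r) f i z).
Proof.
move=> cf; elim: r => [|i r IHr].
  by under eq_fun do rewrite big_nil; exact: cst_continuous.
under eq_fun do rewrite big_cons.
move=> z; apply: (@continuousD _ _ _ (f i) (fun z => \sum_(j <- r) f j z)).
  exact: cf.
exact: IHr.
Qed.

Lemma dot_continuous u : continuous (dot u).
Proof.
apply: continuous_sum => k x; apply: (@continuousM _ _ (fun=> u 0 k) (fun x => x 0 k)).
  exact: cst_continuous.
exact: coord_continuous.
Qed.

Lemma convexE K : convex_set K ->
  forall x y t, 0 <= t <= 1 -> K x -> K y -> K (t *: x + (1 - t) *: y).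
Proof.
move=> cK x y t /andP[t0 t1] Kx Ky.
by have := cK x y (Itv01 t0 t1); rewrite !inE => /(_ Kx Ky).
Qed.

Lemma convex_intro K :
  (forall x y t, 0 <= t <= 1 -> K x -> K y -> K (t *: x + (1 - t) *: y)) ->
  convex_set K.
Proof.
move=> cK x y t; rewrite !inE => Kx Ky; apply: cK => //.
by apply/andP; split; [exact: ge0|exact: le1].
Qed.

Lemma convex_setI K1 K2 : convex_set K1 -> convex_set K2 -> convex_set (K1 `&` K2).
Proof.
move=> c1 c2; apply: convex_intro => x y t t01 [x1 x2] [y1 y2].
by split; exact: convexE.
Qed.

Lemma convex_sum K m (lam : 'I_m -> R) (p : 'I_m -> 'rV[R]_d) : convex_set K ->
  (forall i, 0 <= lam i) -> \sum_i lam i = 1 -> (forall i, K (p i)) ->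
  K (\sum_i lam i *: p i).
Proof.
move=> cK; elim: m lam p => [|m IHm] lam p lam0.
  by rewrite big_ord0 => /eqP; rewrite eq_sym oner_eq0.
rewrite !big_ord_recl /= => lam1 Kp.
have [l1|l1] := eqVneq (lam ord0) 1.
  rewrite big1 ?addr0 ?l1 ?scale1r // => i _.
  have /eqP : \sum_(i < m) lam (lift ord0 i) = 0 by lra.
  rewrite psumr_eq0 // => /allP/(_ i); rewrite mem_index_enum => /(_ isT)/eqP ->.
  by rewrite scale0r.
have s0 : 0 <= \sum_(i < m) lam (lift ord0 i) by exact: sumr_ge0.
have l10 : 1 - lam ord0 != 0 by rewrite subr_eq0 eq_sym.
rewrite (_ : \sum_i _ = (1 - lam ord0) *:
    \sum_i (lam (lift ord0 i) / (1 - lam ord0)) *: p (lift ord0 i)); last first.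
  rewrite scaler_sumr; apply: eq_bigr => i _.
  by rewrite scalerA mulrC divfK.
apply: convexE => //; first by rewrite lam0; lra.
apply: IHm => // [i|]; first by rewrite divr_ge0 //; lra.
by rewrite -mulr_suml (_ : \sum_i _ = 1 - lam ord0) ?divff //; lra.
Qed.

(** The closed convex hull of [P], described from outside by the halfspaces that contain [P]. *)
Definition halfspace_hull P : set 'rV[R]_d :=
  [set x | forall u c, (forall y, P y -> dot u y <= c) -> dot u x <= c].

Lemma sub_halfspace_hull P : P `<=` halfspace_hull P.
Proof. by move=> x Px u c; exact. Qed.

Lemma halfspace_convex u c : convex_set [set x | dot u x <= c].
Proof.
apply: convex_intro => x y t /andP[t0 t1] /= xc yc; rewrite dotDr !dotZr; nra.
Qed.

Lemma halfspace_hull_convex P : convex_set (halfspace_hull P).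
Proof.
apply: convex_intro => x y t t01 xP yP u c Pc.
by apply: (convexE (@halfspace_convex u c)) => //; [exact: xP|exact: yP].
Qed.

Lemma closed_halfspace u c : closed [set x | dot u x <= c].
Proof.
apply: (@preimage_closed _ _ (dot u) [set r | r <= c]) => [x _|].
  exact: dot_continuous.
exact: closed_le.
Qed.

Lemma halfspace_hull_closed P : closed (halfspace_hull P).
Proof.
rewrite (_ : halfspace_hull P = \bigcap_(uc in [set uc : 'rV[R]_d * R |
    forall y, P y -> dot uc.1 y <= uc.2]) [set x | dot uc.1 x <= uc.2]).
  by apply: closed_bigI => uc _; exact: closed_halfspace.
by apply/seteqP; split=> [x xP [u c] /xP //|x xP u c Pc]; exact: (xP (u, c)).
Qed.

Lemma compact_cube m (a b : R) :
  compact [set v : 'rV[R]_m | forall i, v ord0 i \in `[a, b]].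
Proof.
apply: (@rV_compact _ _ (fun=> `[a, b]%classic)) => _; exact: segment_compact.
Qed.

Lemma compact_simplex m :
  compact [set l : 'rV[R]_m | (forall i, l 0 i \in `[0, 1]) /\ \sum_i l 0 i = 1].
Proof.
apply: (@compact_closedI _ [set l : 'rV[R]_m | forall i, l ord0 i \in `[0, 1]]
  [set l : 'rV[R]_m | \sum_i l 0 i = 1]); first exact: compact_cube.
apply: (@preimage_closed _ _ (fun l : 'rV[R]_m => \sum_i l 0 i) [set r | r = 1]).
  by move=> x _; apply: continuous_sum => i; exact: coord_continuous.
exact: closed_eq.
Qed.

(* If [pt l0] is the point of the polytope nearest to [x], then the functional
   [x - pt l0] attains its maximum over the polytope at [pt l0]. *)
Lemma halfspace_hull_min P K : finite_set P -> convex_set K -> P `<=` K ->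
  halfspace_hull P `<=` K.
Proof.
move=> /finite_seqP[s ->] cK PK x xP.
pose m := size s; pose p (i : 'I_m) := tnth (in_tuple s) i.
have Kp i : K (p i) by apply: PK; rewrite /= mem_tnth.
have sp y : y \in s -> exists i, y = p i.
  by move=> /(tnthP (in_tuple s)).
have [m0|m0] := posnP m.
  (* For empty [P] even the functional [0] is bounded by [-1] on [P], so the hull is empty. *)
  suff : dot 0 x <= -1 by rewrite dotC dot0r oppr_ge0 ler10.
  by apply: xP => y /sp[[i im]]; exfalso; move: im; rewrite m0.
pose pt (l : 'rV[R]_m) : 'rV[R]_d := \sum_i l 0 i *: p i.
pose D := [set l : 'rV[R]_m | (forall i, l 0 i \in `[0, 1]) /\ \sum_i l 0 i = 1].
pose F (l : 'rV[R]_m) := dot (pt l - x) (pt l - x).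
have D0 : D !=set0.
  exists (delta_mx 0 (Ordinal m0)); split=> [i|].
    by rewrite mxE in_itv /= ler0n lern1 leq_b1.
  rewrite (bigD1 (Ordinal m0)) //= mxE !eqxx big1 ?addr0 // => i /negbTE im.
  by rewrite mxE im andbF.
have cF : continuous F.
  have cpt k : continuous (fun l => (pt l - x) 0 k).
    under eq_fun do rewrite mxE summxE.
    move=> l; apply: (@continuousD _ _ _ (fun l : 'rV[R]_m =>
      \sum_i (l 0 i *: p i) 0 k) (fun=> (- x) 0 k)); last exact: cst_continuous.
    apply: continuous_sum => i {}l; under eq_fun do rewrite mxE.
    apply: (@continuousM _ _ (fun l : 'rV[R]_m => l 0 i) (fun=> p i 0 k)).
      exact: coord_continuous.
    exact: cst_continuous.
  by apply: continuous_sum => k l; apply: continuousM; exact: cpt.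
have [l0 /set_mem[l01 l0s] minF] := EVT_min_rV D0 (@compact_simplex m) (continuous_subspaceT cF).
pose v := x - pt l0.
have l0_ge0 i : 0 <= l0 0 i by have := l01 i; rewrite in_itv /= => /andP[].
have Kpt : K (pt l0) by apply: convex_sum.
suff /dot_eq0/subr0_eq -> : dot v v <= 0 by [].
suff : dot v x <= dot v (pt l0) by rewrite {3}/v dotDr dotNr; lra.
apply: xP => _ /sp[i ->].
rewrite -subr_le0 -dotNr -dotDr leNgt; apply/negP.
set w := p i - pt l0 => vw.
have ww : 0 <= dot w w by exact: dot_ge0.
(* A step length from [pt l0] towards [p i] that is at most 1 and satisfies
   [e * dot w w <= dot v w], so that the distance to [x] would drop strictly. *)
pose e := dot v w / (dot v w + dot w w).
have vww : 0 < dot v w + dot w w by lra.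
have e0 : 0 < e by rewrite divr_gt0.
have e1 : e <= 1 by rewrite ler_pdivrMr // mul1r; lra.
have ew : e * dot w w <= dot v w by rewrite /e mulrAC ler_pdivrMr // ler_pM2l //; lra.
clearbody e.
pose l := l0 + e *: (delta_mx 0 i - l0).
have lE j : l 0 j = (1 - e) * l0 0 j + e * (j == i)%:R.
  by rewrite !mxE eqxx /=; ring.
have sumd (V : lmodType R) (f : 'I_m -> V) : \sum_j (j == i)%:R *: f j = f i.
  rewrite (bigD1 i) //= eqxx scale1r big1 ?addr0 // => j /negbTE ->.
  by rewrite scale0r.
have Dl : D l.
  split=> [j|].
    rewrite lE in_itv /=; have := l01 j; rewrite in_itv /= => /andP[lj0 lj1].
    case: (j == i); rewrite ?mulr1 ?mulr0; nra.
  under eq_bigr do rewrite lE.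
  rewrite big_split -!mulr_sumr l0s /=.
  have -> : \sum_j (j == i)%:R = 1 :> R.
    by rewrite (bigD1 i) //= eqxx big1 ?addr0 // => j /negbTE ->.
  by ring.
have ptl : pt l - x = - v + e *: w.
  rewrite /pt; under eq_bigr do rewrite lE scalerDl -!scalerA.
  rewrite big_split -!scaler_sumr sumd -/(pt l0) /w /v /=.
  by apply/rowP => k; rewrite !mxE; ring.
have := minF l (mem_set Dl); rewrite /F ptl.
have -> : pt l0 - x = - v by rewrite opprB.
clearbody v w; rewrite !(dotNr, dotNl) opprK dotDr dotZr dotNr ![dot (- v + _) _]dotC.
rewrite !(dotDr, dotZr, dotNr) (dotC w v) => H.
have : 2 * dot v w * e <= e * dot w w * e by lra.
rewrite ler_pM2r //; lra.
Qed.

End ConvexGeometry.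

(** * Halfspaces from Helly's property *)

Section HellyNumber.
Variables (R : realType) (d : nat) (M : set 'rV[R]_d) (h : nat).
Hypotheses (M_neq0 : M !=set0) (M_closed : closed M) (hellyM : helly_property M h).

(** For [h = 0] a single empty set is a counterexample, because the empty subfamily meets in the
    non-empty [M]. *)
Lemma helly_gt0 : (0 < h)%N.
Proof.
rewrite lt0n; apply/eqP => h0.
case: (@hellyM 1%N (fun=> set0)) => [||I cI|x [_ /(_ ord0)]].
- by rewrite h0.
- by move=> _; exists set0; rewrite ?setI0 // => x y t; rewrite inE.
- have {cI} -> : I = finset.set0 by apply/eqP; rewrite -cards_eq0 cI h0.
  by have [x Mx] := M_neq0; exists x; split=> // i /=; rewrite inE.
- by rewrite /= inE; apply.
Qed.

Lemma helly_select (T : eqType) (s : seq T) (K : T -> set 'rV[R]_d) :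
  (forall t, convex_set (K t)) ->
  (forall x, M x -> exists2 t, t \in s & ~ K t x) ->
  exists2 f : 'I_h -> T, (forall i, f i \in s) &
    forall x, M x -> exists i, ~ K (f i) x.
Proof.
move=> cK noK; have [x0 Mx0] := M_neq0; have [t0 t0s _] := noK _ Mx0.
(* The copies of [t0] ensure a length of at least [h] without adding new sets. *)
pose s' := s ++ nseq h t0.
have ss' t : t \in s' -> t \in s by rewrite mem_cat => /orP[//|/nseqP[-> _]].
apply: contrapT => nof.
case: (@hellyM (size s') (fun i => M `&` K (tnth (in_tuple s') i))) => [|i|I cI|x [Mx Kx]].
- by rewrite size_cat size_nseq leq_addl.
- by exists (K (tnth (in_tuple s') i)).
- apply: contrapT => noI; apply: nof.
  pose g (i : 'I_h) := enum_val (cast_ord (esym cI) i).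
  exists (fun i => tnth (in_tuple s') (g i)) => [i|x Mx].
    by apply: ss'; exact: mem_tnth.
  apply: contrapT => noi; apply: noI; exists x; split=> // j /= jI; split=> //.
  apply: contrapT => nj; apply: noi; exists (cast_ord cI (enum_rank_in jI j)).
  by rewrite /g cast_ordK enum_rankK_in.
- have [t ts []] := noK _ Mx.
  have : t \in s' by rewrite mem_cat ts.
  by move=> /(tnthP (in_tuple s'))[i ->]; have [] := Kx i; rewrite /= ?inE.
Qed.

(** The hulls of the [P i] have no common point in [M], so every point of [M] violates a halfspace
    containing some [P i]. Compactness leaves finitely many of these on [B], and Helly's property,
    with [B] as one more convex set, leaves [h]. *)
Lemma helly_halfspaces (B : set 'rV[R]_d) (P A : 'I_h -> set 'rV[R]_d) :
  compact B -> convex_set B ->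
  (forall i, finite_set (P i)) -> (forall i, convex_set (A i)) ->
  (forall i, P i `<=` A i) -> (forall x, M x -> exists i, ~ A i x) ->
  exists (u : 'I_h -> 'rV[R]_d) (c : 'I_h -> R) (iota : 'I_h -> 'I_h),
    (forall s y, P (iota s) y -> dot (u s) y <= c s) /\
    (forall y, M y -> B y -> exists s, c s < dot (u s) y).
Proof.
move=> cptB convB finP cA PA noA.
have /choice[G GE] : forall y, exists g : 'I_h * 'rV[R]_d * R, M y ->
    (forall z, P g.1.1 z -> dot g.1.2 z <= g.2) /\ g.2 < dot g.1.2 y.
  move=> y; have [My|] := pselect (M y); last first.
    by exists (Ordinal helly_gt0, 0, 0).
  have [i nAi] := noA _ My; apply: contrapT => nog; apply: nAi.
  apply: (halfspace_hull_min (finP i) (cA i) (PA i)) => u c Pc.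
  rewrite leNgt; apply/negP => cu; apply: nog; by exists (i, u, c).
have := compact_closedI cptB M_closed; rewrite compact_cover.
case/(_ _ M (fun y => [set z | (G y).2 < dot (G y).1.2 z])).
- move=> y _; apply: (@open_comp _ _ (dot (G y).1.2) [set r | (G y).2 < r]).
    by move=> z _; exact: dot_continuous.
  exact: open_gt.
- by move=> y [_ My]; exists y => //; exact: (GE y My).2.
move=> D DM cover.
pose K (o : option 'rV[R]_d) := if o is Some y then [set z | dot (G y).1.2 z <= (G y).2] else B.
have [||f fD Kf] := @helly_select (option 'rV[R]_d)
    (None :: [seq Some y | y <- finmap.enum_fset D]) K.
- by case=> // y; exact: halfspace_convex.
- move=> x Mx; have [Bx|] := pselect (B x); last by exists None; rewrite ?mem_head.
  have [y yD /= lt_y] := cover x (conj Bx Mx).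
  exists (Some y); first by rewrite inE map_f.
  by apply/negP; rewrite -ltNge.
(* Where [f] picks [B], the trivial halfspace [dot 0 y <= 0] fills the slot. *)
exists (fun s => if f s is Some y then (G y).1.2 else 0).
exists (fun s => if f s is Some y then (G y).2 else 0).
exists (fun s => if f s is Some y then (G y).1.1 else Ordinal helly_gt0).
split=> [s y|y My By].
  have := fD s; case: (f s) => [z|_ _]; last by rewrite dotC dot0r.
  rewrite inE /= mem_map => [|? ? []//] zD Py.
  by apply: (GE z _).1 => //; apply/set_mem/DM.
have [s nK] := Kf _ My; exists s.
by case: (f s) nK => [z /negP|//]; rewrite -ltNge.
Qed.

End HellyNumber.

(** * Cubes, and sign patterns of affine functions *)

Lemma cube_convex (R : realType) d (a b : R) :
  convex_set [set v : 'rV[R]_d | forall i, v ord0 i \in `[a, b]].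
Proof.
apply: convex_intro => x y t /andP[t0 t1] xab yab i; have := xab i; have := yab i.
rewrite !in_itv /= !mxE => /andP[y1 y2] /andP[x1 x2]; nra.
Qed.

Lemma finite_in_cube (R : realType) d (T : finType) (p : T -> 'rV[R]_d) :
  exists a : R, forall t i, p t ord0 i \in `[- a, a].
Proof.
exists (\sum_t \sum_i `|p t ord0 i|) => t i.
rewrite in_itv /= -ler_norml (bigD1 t) //= (bigD1 i) //= -addrA lerDl.
by rewrite addr_ge0 ?sumr_ge0 // => ? _; rewrite sumr_ge0.
Qed.

(* The linear parts of [d.+1] affine functions on a [d]-dimensional space are
   linearly dependent, so some combination [lam] of the functions is constant;
   the patterns [0 < lam] and [lam < 0] force it to have both signs. *)
Lemma affine_signs (R : realType) d (u : 'I_d.+1 -> 'rV[R]_d) (c : 'I_d.+1 -> R)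
    (q : ('I_d.+1 -> bool) -> 'rV[R]_d) :
  ~ (forall e j, if e j then c j < dot (u j) (q e) else dot (u j) (q e) <= c j).
Proof.
move=> H; pose U := \matrix_(j < d.+1, k < d) u j 0 k.
have /rowV0Pn[lam /sub_kermxP lamU lam0] : kermx U != 0.
  by rewrite -mxrank_eq0 mxrank_ker subn_eq0 -ltnNge ltnS rank_leq_col.
have cst x : \sum_j lam 0 j * (dot (u j) x - c j) = - \sum_j lam 0 j * c j.
  under eq_bigr do rewrite mulrBr.
  rewrite big_split /= sumrN -[RHS]add0r; congr (_ + _).
  under eq_bigr do rewrite mulr_sumr.
  rewrite exchange_big big1 // => k _; under eq_bigr do rewrite mulrA.
  have lamUk : \sum_j lam 0 j * u j 0 k = (lam *m U) 0 k.
    by rewrite mxE; apply: eq_bigr => j _; rewrite mxE.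
  by rewrite -mulr_suml lamUk lamU mxE mul0r.
pose e1 j := 0 < lam 0 j; pose e2 j := lam 0 j < 0.
have t1 j : 0 <= lam 0 j * (dot (u j) (q e1) - c j).
  by have := H e1 j; rewrite /e1; case: ltrP => l0 f; [apply: mulr_ge0|apply: mulr_le0]; lra.
have t2 j : 0 <= - (lam 0 j * (dot (u j) (q e2) - c j)).
  have := H e2 j; rewrite /e2 oppr_ge0.
  by case: ltrP => l0 f; [apply: mulr_le0_ge0|apply: mulr_ge0_le0]; lra.
have s1 : \sum_j lam 0 j * (dot (u j) (q e1) - c j) = 0.
  apply/le_anti; rewrite sumr_ge0 // andbT cst -(cst (q e2)) -oppr_ge0 -sumrN.
  exact: sumr_ge0.
have s2 : \sum_j - (lam 0 j * (dot (u j) (q e2) - c j)) = 0.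
  by rewrite sumrN cst -(cst (q e1)) s1 oppr0.
(* All terms of both sums vanish, so a non-zero [lam 0 j] would put [q e1] and [q e2] on the
   hyperplane of index [j], although one of the two patterns demands its strict side. *)
move/eqP: lam0; apply; apply/rowP => j; rewrite mxE; apply/eqP.
move/eqP: s1; rewrite psumr_eq0 // => /allP/(_ j); rewrite mem_index_enum => /(_ isT) /=.
move/eqP: s2; rewrite psumr_eq0 // => /allP/(_ j); rewrite mem_index_enum => /(_ isT) /=.
rewrite oppr_eq0 !mulf_eq0; case: eqP => //= /eqP lj f2 f1.
have := H e1 j; have := H e2 j; rewrite /e1 /e2.
move: lj; rewrite neq_lt => /orP[l0|l0]; rewrite l0; lra.
Qed.

(** * Rainbow families *)

Section Colored.
Variables (R : realType) (d : nat) (M : set 'rV[R]_d) (h : nat).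
Hypotheses (M_neq0 : M !=set0) (M_closed : closed M) (hellyM : helly_property M h).
Variables (J I : finType) (p : {ffun J -> I} -> 'rV[R]_d) (A : J -> I -> set 'rV[R]_d).
Hypotheses (A_convex : forall j i, convex_set (A j i)) (pM : forall b, M (p b)).
Hypothesis pA : forall (b : {ffun J -> I}) j, A j (b j) (p b).
Hypothesis A_free : forall j (Y : 'I_h -> I), injective Y ->
  forall x, M x -> exists s, ~ A j (Y s) x.

(** What is separated is not [A j i] and [A j i'] but the points chosen in them for tuples of the
    grid; this survives shrinking. *)
Definition separates (S : J -> {set I}) j i i' := exists u c, forall b, in_grid S b ->
  (b j = i -> dot u (p b) <= c) /\ (b j = i' -> c < dot u (p b)).

Definition pairwise_separated j (S : J -> {set I}) := forall i i',
  i \in S j -> i' \in S j -> i != i' -> separates S j i i' \/ separates S j i' i.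

Lemma pairwise_separatedS j S S' :
  subgrid S' S -> pairwise_separated j S -> pairwise_separated j S'.
Proof.
move=> sS sepS i i' /(fintype.subsetP (sS j)) iS /(fintype.subsetP (sS j)) i'S ii'.
have sub a a' : separates S j a a' -> separates S' j a a'.
  by case=> u [c uc]; exists u, c => b /(in_gridS sS)/uc.
by case: (sepS i i' iS i'S ii') => /sub; [left|right].
Qed.

(* [n] is a Ramsey number and [q n] counts the patterns of memberships of a point
   in the halfspaces attached to the h-tuples of [n] sets. *)
Definition separation_size (q : nat -> nat) (r k : nat) : nat :=
  let n := (2 ^ (k + h))%N in
  maxn n (iter r (grid_pigeonhole_size (q n) r) k.+1).

Definition pattern n := {ffun 'I_n * ({ffun 'I_h -> 'I_n} * 'I_h) -> bool}.

(** After a pigeonhole that makes [chi] constant, Ramsey's theorem is applied to the graph of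
    separated pairs: [h] pairwise unseparated sets contradict [A_free], so a clique of size [k]
    exists. *)
Lemma separation_step j k S :
  large (separation_size (fun n => #|{: pattern n}|) #|J| k) S ->
  exists S', [/\ subgrid S' S, large k S' & pairwise_separated j S'].
Proof.
set n := (2 ^ (k + h))%N => lS.
have nS : (n <= #|S j|)%N by apply: leq_trans (lS j); rewrite /separation_size leq_maxl.
pose f (i : 'I_n) := enum_val (widen_ord nS i).
have fS i : f i \in S j by exact: enum_valP.
have f_inj : injective f by move=> i i' /enum_val_inj/(congr1 val) /= ii'; exact: val_inj.
have [a pB] := finite_in_cube p.
set B := [set v : 'rV[R]_d | forall i, v ord0 i \in `[- a, a]].
pose P (Y : {ffun 'I_h -> 'I_n}) s := [set p b | b in [set b : {ffun J -> I} | b j = f (Y s)]].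
have /choice[G GE] : forall Y : {ffun 'I_h -> 'I_n},
    exists g : ('I_h -> 'rV[R]_d) * ('I_h -> R) * ('I_h -> 'I_h),
    injective Y -> (forall s y, P Y (g.2 s) y -> dot (g.1.1 s) y <= g.1.2 s) /\
      (forall y, M y -> B y -> exists s, g.1.2 s < dot (g.1.1 s) y).
  move=> Y; have [injY|] := pselect (injective Y); last first.
    by exists (fun=> 0, fun=> 0, id).
  have [||s y [b /= <- <-]|x Mx|u [c [iota [uP uM]]]] :=
      @helly_halfspaces _ _ _ _ M_neq0 M_closed hellyM B (P Y)
        (fun s => A j (f (Y s))) (@compact_cube _ _ _ _) (@cube_convex _ _ _ _).
  - by move=> s; apply: finite_image; exact: finite_finset.
  - by move=> s; exact: A_convex.
  - exact: pA.
  - by have [s] := A_free j (inj_comp f_inj injY) Mx; exists s.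
  - by exists (u, c, iota).
pose chi b : pattern n := [ffun z =>
  (G z.2.1).1.2 z.2.2 < dot ((G z.2.1).1.1 z.2.2) (p (update b j (f z.1)))].
(* [k.+1] instead of [k] makes the grid non-empty, so that the reference tuple [b0] exists. *)
have [S1 [sS1 lS1 chiS1]] : exists S', [/\ subgrid S' S, large k.+1 S' &
    forall b b', in_grid S' b -> in_grid S' b' -> chi b = chi b'].
  by apply: grid_pigeonhole => i; apply: leq_trans (lS i); exact: leq_maxr.
have [b0 b0S] : exists b0, in_grid S1 b0.
  have /fin_all_exists[b0 b0S] : forall i, exists x, x \in S1 i.
    by move=> i; apply/card_gt0P/(leq_trans _ (lS1 i)).
  by exists [ffun i => b0 i]; apply/forallP => i; rewrite ffunE.
pose sep i i' := exists u c, forall b, in_grid S1 b ->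
  dot u (p (update b j (f i))) <= c /\ c < dot u (p (update b j (f i'))).
pose e i i' := `[< sep i i' \/ sep i' i >].
have sym_e : symmetric e.
  by move=> i i'; apply/asbool_equiv_eq; split; case; [right|left|right|left].
have [|[Z [_ cZ] eZ]|[Z [_ cZ] eZ]] := @ramsey _ e k h [set: 'I_n]%SET sym_e.
- by rewrite cardsT card_ord.
- exists (fun i => if i == j then f @: Z else S1 i)%SET.
  have sub : subgrid (fun i => if i == j then f @: Z else S1 i)%SET S.
    move=> i; case: eqP => [->|_]; last exact: sS1.
    by apply/fintype.subsetP => _ /imsetP[z _ ->].
  split=> // [i|].
    by case: eqP => _; [rewrite card_imset // cZ|exact: leq_trans (lS1 i)].
  have sepE z z' : sep z z' ->
      separates (fun i => if i == j then f @: Z else S1 i)%SET j (f z) (f z').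
    case=> u [c uc]; exists u, c => b /forallP bS.
    (* At colour [j] the tuple [b] runs through [f @: Z] and not [S1 j]; the entry [b0 j] brings it
       back into the grid of [sep]. *)
    have [|le_c gt_c] := uc (update b j (b0 j)).
      apply/forallP => i; rewrite ffunE; have := bS i; case: eqP => // -> _.
      exact: (forallP b0S).
    have upd x : b j = x -> update (update b j (b0 j)) j x = b.
      by move=> bj; apply/ffunP => i; rewrite !ffunE; case: eqP => [->|].
    by split=> /upd bE; rewrite -bE.
  move=> i i'; rewrite eqxx => /imsetP[z zZ ->] /imsetP[z' z'Z ->] zz'.
  have /asboolP[/sepE|/sepE] : e z z' by apply: eZ => //; apply: contraNneq zz' => ->.
    by left.
  by right.
- have h0 := helly_gt0 M_neq0 hellyM.
  pose Y := [ffun s => enum_val (cast_ord (esym cZ) s)].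
  have YZ s : Y s \in Z by rewrite ffunE; exact: enum_valP.
  have Y_inj : injective Y.
    by move=> s s'; rewrite !ffunE => /enum_val_inj/cast_ord_inj.
  have [GP GM] := GE Y Y_inj.
  (* The point through [Y s0] misses the halfspace containing the set [Y (iota s)],
     and so do, [chi] being constant, all points through [Y s0] on [S1]. *)
  pose s0 := Ordinal h0; have [||s lt_s] := GM (p (update b0 j (f (Y s0)))).
  + exact: pM.
  + exact: pB.
  have PE t b : P Y t (p (update b j (f (Y t)))).
    by exists (update b j (f (Y t))); rewrite //= ffunE eqxx.
  have ne : Y ((G Y).2 s) != Y s0.
    by apply: contraTneq lt_s => <-; rewrite -leNgt; apply: GP.
  have := eZ _ _ (YZ _) (YZ _) ne; suff -> : e (Y ((G Y).2 s)) (Y s0) by [].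
  apply/asboolP; left; exists ((G Y).1.1 s), ((G Y).1.2 s) => b bS; split; first exact: GP.
  have /ffunP/(_ (Y s0, (Y, s))) := chiS1 _ _ bS b0S.
  by rewrite [LHS]ffunE [RHS]ffunE /= lt_s.
Qed.

End Colored.

(** Computed backwards from the two sets per colour that remain, with one separation step per
    colour. *)
Definition colored_helly_size h r :=
  iter r (separation_size h (fun n => #|{: pattern h n}|) r) 2.

Lemma colored_helly (R : realType) d (M : set 'rV[R]_d) h (I : finType)
    (p : {ffun 'I_d.+1 -> I} -> 'rV[R]_d) (A : 'I_d.+1 -> I -> set 'rV[R]_d) :
  M !=set0 -> closed M -> helly_property M h ->
  (colored_helly_size h d.+1 <= #|I|)%N ->
  (forall j i, convex_set (A j i)) -> (forall b, M (p b)) ->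
  (forall (b : {ffun _ -> I}) j, A j (b j) (p b)) ->
  exists j (Y : 'I_h -> I), injective Y /\ exists2 x, M x & forall s, A j (Y s) x.
Proof.
move=> M0 clM hM big cA pM pA; apply: contrapT => noY.
have A_free j (Y : 'I_h -> I) : injective Y -> forall x, M x -> exists s, ~ A j (Y s) x.
  move=> injY x Mx; apply: contrapT => nos; apply: noY; exists j, Y; split=> //.
  by exists x => // s; apply: contrapT => ns; apply: nos; exists s.
have := @shrink_all 'I_d.+1 I _ _ (@pairwise_separatedS _ _ _ _ p)
  (@separation_step _ _ _ _ M0 clM hM _ _ _ _ cA pM pA A_free) 2 (fun=> finset.setT).
case=> [i|S [_ lS sepS]]; first by rewrite cardsT card_ord.
have /choice[g gE] : forall j, exists g : I * I * 'rV[R]_d * R,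
    [/\ g.1.1.1 \in S j, g.1.1.2 \in S j & forall b, in_grid S b ->
      (b j = g.1.1.1 -> dot g.1.2 (p b) <= g.2) /\
      (b j = g.1.1.2 -> g.2 < dot g.1.2 (p b))].
  move=> j; have /card_gt1P[i [i' [iS i'S ii']]] := lS j.
  case: (sepS j i i' iS i'S ii') => -[u [c uc]].
    by exists (i, i', u, c).
  by exists (i', i, u, c).
pose b (e : 'I_d.+1 -> bool) := [ffun j => if e j then (g j).1.1.2 else (g j).1.1.1].
apply: (@affine_signs R d (fun j => (g j).1.2) (fun j => (g j).2) (fun e => p (b e))) => e j.
have bS : in_grid S (b e).
  by apply/forallP => k; rewrite ffunE; have [? ? _] := gE k; case: ifP.
have [_ _ /(_ _ bS)[le_c gt_c]] := gE j.
by case: ifP => ej; [apply: gt_c|apply: le_c]; rewrite ffunE ej.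
Qed.

(** * From tuples to a common point *)

Section Lexicographic.
Variables (R : realType) (d : nat).
Implicit Types (x y : 'rV[R]_d) (Z : set 'rV[R]_d).

Definition lex_lt x y := exists i : 'I_d,
  (forall j : 'I_d, (j < i)%N -> x 0 j = y 0 j) /\ x 0 i < y 0 i.

Lemma lex_total x y : x <> y -> lex_lt x y \/ lex_lt y x.
Proof.
move=> /eqP; rewrite -subr_eq0 => /rV0Pn[i0]; rewrite !mxE subr_eq0 => ne.
have [i ni mini] := @arg_minnP _ i0 (fun i => x 0 i != y 0 i) val ne.
have eq_lt (j : 'I_d) : (j < i)%N -> x 0 j = y 0 j.
  by move=> ji; apply/eqP; apply: contraTT ji => /mini; rewrite -leqNgt.
move: ni; rewrite neq_lt => /orP[lt_i|lt_i]; [left|right]; exists i; split=> // j ji.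
by rewrite eq_lt.
Qed.

(** At the smaller of the two deciding indices one point is strictly below [x] and the other at most
    equal, while all earlier coordinates agree with [x]. *)
Lemma lex_convex x : convex_set [set y | lex_lt y x].
Proof.
apply: convex_intro => y z t /andP[t0 t1] [i [yi lt_i]] [k [zk lt_k]].
have [->|tN0] := eqVneq t 0; first by rewrite scale0r add0r subr0 scale1r; exists k.
have [->|tN1] := eqVneq t 1; first by rewrite scale1r subrr scale0r addr0; exists i.
have {tN0} t_gt0 : 0 < t by rewrite lt_neqAle eq_sym tN0.
have {tN1} t_lt1 : 0 < 1 - t by rewrite subr_gt0 lt_neqAle tN1.
have eq_lt (j : 'I_d) : (j < i)%N -> (j < k)%N -> (t *: y + (1 - t) *: z) 0 j = x 0 j.
  by move=> ji jk; rewrite !mxE yi // zk //; ring.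
have [ik|ki|/val_inj ik] := ltngtP i k.
- exists i; split=> [j ji|]; first by rewrite eq_lt // (ltn_trans ji).
  by rewrite !mxE zk //; nra.
- exists k; split=> [j jk|]; first by rewrite eq_lt // (ltn_trans jk).
  by rewrite !mxE yi //; nra.
- subst k; exists i; split=> [j ji|]; first by rewrite eq_lt.
  by rewrite !mxE; nra.
Qed.

(** One coordinate is minimized after another, each time on the compact set of points that agree
    with the previous minimizer so far. *)
Lemma lex_min Z : compact Z -> Z !=set0 ->
  exists x, Z x /\ forall y, Z y -> ~ lex_lt y x.
Proof.
move=> cZ Z0.
suff H k : (k <= d)%N -> exists x, Z x /\ forall y, Z y -> ~ exists i : 'I_d,
    [/\ (i < k)%N, forall j : 'I_d, (j < i)%N -> y 0 j = x 0 j & y 0 i < x 0 i].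
  have [x [Zx minx]] := H d (leqnn d); exists x; split=> // y /minx ny [i [yi lt_i]].
  by apply: ny; exists i.
elim: k => [_|k IHk kd].
  by have [x Zx] := Z0; exists x; split=> // y _ [i []].
have [x [Zx minx]] := IHk (ltnW kd).
pose k' := Ordinal kd.
pose Zk := Z `&` [set y | forall j : 'I_d, (j < k)%N -> y 0 j = x 0 j].
have cZk : compact Zk.
  apply: compact_closedI => //.
  rewrite (_ : mkset _ = \bigcap_(j in [set j : 'I_d | (j < k)%N]) [set y | y 0 j = x 0 j]).
    apply: closed_bigI => j _.
    apply: (@preimage_closed _ _ (fun y : 'rV[R]_d => y 0 j) [set r | r = x 0 j]).
      by move=> y _; exact: coord_continuous.
    exact: closed_eq.
  by apply/seteqP; split.
have Zk0 : Zk !=set0 by exists x.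
have [z /set_mem[Zz zx] minz] := EVT_min_rV Zk0 cZk
  (continuous_subspaceT (@coord_continuous _ _ _ ord0 k')).
exists z; split=> // y Zy [i []]; rewrite ltnS leq_eqVlt => /orP[/eqP ik|ik] yz lt_i.
  have ik' : i = k' by apply: val_inj.
  have /minz : y \in Zk.
    by apply/mem_set; split=> // j jk; rewrite -zx // yz // ik.
  by rewrite leNgt -ik' lt_i.
apply: (minx y Zy); exists i; split=> // [j ji|]; last by rewrite -zx.
by rewrite yz // zx // (ltn_trans ji).
Qed.

End Lexicographic.

Section FractionalHelly.
Variables (R : realType) (d : nat) (M : set 'rV[R]_d) (h : nat).
Hypotheses (M_neq0 : M !=set0) (M_closed : closed M) (hellyM : helly_property M h).

Definition meets n (C : 'I_n -> set 'rV[R]_d) k (f : {ffun 'I_k -> 'I_n}) : bool :=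
  `[< exists x, M x /\ forall s, C (f s) x >].

(* By Helly's property for [h + 1] sets, one of which is [{y | y < x}], the
   lexicographic minimum [x] of [h] sets is already the minimum of [h - 1] of them. *)
Lemma lex_min_determined (B : set 'rV[R]_d) (Q : 'I_h -> set 'rV[R]_d) x :
  convex_set B -> (forall s, convex_set (Q s)) ->
  M x -> B x -> (forall s, Q s x) ->
  (forall y, M y -> B y -> (forall s, Q s y) -> ~ lex_lt y x) ->
  exists s0, forall y, M y -> B y -> (forall s, s != s0 -> Q s y) -> ~ lex_lt y x.
Proof.
move=> cB cQ Mx Bx Qx minx.

pose K (t : option 'I_h) := if t is Some s then Q s else B `&` [set y | lex_lt y x].
have [||f _ Kf] := @helly_select _ _ _ _ M_neq0 hellyM _ (enum {: option 'I_h}) K.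
- by case=> [s|]; [exact: cQ|apply: convex_setI => //; exact: lex_convex].
- move=> y My; apply: contrapT => noK.
  have Ky t : K t y.
    by apply: contrapT => nK; apply: noK; exists t; rewrite ?mem_enum.
  have [By lt_y] := Ky None.
  by apply: (minx y My By) => // s; exact: (Ky (Some s)).
(* Having at most [h] values, [f] misses one of the [h + 1] sets; it can be taken among the [Q s],
   since [x] lies in all of these. *)
have [t ft] : exists t, t \notin codom f.
  apply/existsP; rewrite -negb_forall; apply/negP => /forallP all_f.
  have : (#|{: option 'I_h}| <= #|codom f|)%N.
    by apply/subset_leq_card/fintype.subsetP => t _.
  rewrite card_option card_ord => /leq_trans/(_ (card_size _)).
  by rewrite size_codom card_ord ltnn.
case: t ft => [s0|] ft; last first.
  have [i] := Kf _ Mx; have := codom_f f i.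
  by case fiE : (f i) => [s|] /=; [move=> _; case; exact: Qx|rewrite (negPf ft)].
exists s0 => y My By Qy lt_y.
have [i] := Kf _ My; have := codom_f f i.
case fiE : (f i) => [s|] /= sf; case=> //; apply: Qy.
by apply: contraNneq ft => <-.
Qed.

(** Each meeting tuple is charged to an [s0] such that the minimum over the other [h - 1] sets lies
    in [C (f s0)]. With the other indices fixed, this minimum is one point, so at most [m] values of
    [f s0] remain. *)
Lemma fractional_helly_count n (C : 'I_n -> set 'rV[R]_d) m :
  (forall i, relatively_convex M (C i)) ->
  (forall x, #|[pred i | `[< C i x >]]| <= m)%N ->
  (#|[pred f : {ffun 'I_h -> 'I_n} | meets C f]| * n <= h * (n ^ h * m))%N.
Proof.
move=> rcC le_m.
have /choice[K KE] : forall i, exists K, convex_set K /\ C i = M `&` K.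
  by move=> i; have [K cK ->] := rcC i; exists K.
have /choice[z zE] : forall f : {ffun 'I_h -> 'I_n}, exists x,
    meets C f -> M x /\ forall s, C (f s) x.
  move=> f; have [/asboolP[x xE]|nf] := boolP (meets C f); first by exists x.
  by exists 0.
have [a zB] := finite_in_cube z.
set B := [set v : 'rV[R]_d | forall i, v ord0 i \in `[- a, a]].
(* The [K i] may be neither closed nor bounded; hulls of finitely many chosen points, cut with [B]
   and [M], are compact and so have minima. *)
pose P i := [set z f | f in [set f : {ffun 'I_h -> 'I_n} | meets C f /\ exists s, f s = i]].
pose Q i := halfspace_hull (P i).
have QK i : Q i `<=` K i.
  apply: halfspace_hull_min.
  - by apply: finite_image; exact: finite_finset.
  - exact: (KE i).1.
  - by move=> _ [f [/zE[_ zC] [s <-]] <-]; have := zC s; rewrite (KE (f s)).2 => -[].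
have QP f s : meets C f -> Q (f s) (z f).
  by move=> fC; apply: sub_halfspace_hull; exists f => //=; split=> //; exists s.
(* The minimum is a function of the set alone, so it does not change when [f s0] varies and the
   other indices stay. *)
have /choice[X XE] : forall Z : set 'rV[R]_d, exists x, compact Z -> Z !=set0 ->
    Z x /\ forall y, Z y -> ~ lex_lt y x.
  move=> Z; have [cZ|] := pselect (compact Z); last by exists 0.
  have [Z0|] := pselect (Z !=set0); last by exists 0.
  by have [x xE] := lex_min cZ Z0; exists x.
pose Z (f : {ffun 'I_h -> 'I_n}) (D : set 'I_h) := B `&` (M `&` \bigcap_(s in D) Q (f s)).
have cZ f D : compact (Z f D).
  apply: compact_closedI; first exact: compact_cube.
  by apply: closedI => //; apply: closed_bigI => s _; exact: halfspace_hull_closed.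
have key f : meets C f -> exists s0, C (f s0) (X (Z f [set s | s != s0])).
  move=> fC; have [Mz _] := zE f fC.
  have [||[Bx [Mx Qx]] minx] := XE (Z f setT); [exact: cZ| |].
    by exists (z f); split; [exact: zB|split=> // s _; exact: QP].
  set x := X _ in Bx Mx Qx minx.
  have [||||s|y My By Qy|s0 mins0] := @lex_min_determined B (fun s => Q (f s)) x.
  - exact: cube_convex.
  - by move=> s; exact: halfspace_hull_convex.
  - exact: Mx.
  - exact: Bx.
  - exact: Qx.
  - by apply: minx; split=> //; split=> // s _.
  exists s0; set x' := X _.
  have Zx : Z f [set s | s != s0] x by split=> //; split=> // s _; exact: Qx.
  have [[Bx' [Mx' Qx']] minx'] := XE _ (cZ f [set s | s != s0]) (ex_intro _ x Zx).
  suff -> : x' = x by rewrite (KE (f s0)).2; split=> //; apply: QK; exact: Qx.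
  apply: contrapT => /lex_total[]; first exact: mins0.
  exact: minx'.
pose G s0 (f : {ffun 'I_h -> 'I_n}) : nat := `[< C (f s0) (X (Z f [set s | s != s0])) >].
apply: (@leq_trans ((\sum_s0 \sum_f G s0 f) * n)).
  rewrite leq_mul2r exchange_big -sum1_card big_mkcond leq_sum ?orbT //= => f _.
  rewrite inE; case: ifP => // /key[s0 Cs0].
  by rewrite (bigD1 s0) //= /G asboolT.
rewrite big_distrl /= -[h in (h * _)%N]card_ord -sum_nat_const; apply: leq_sum => s0 _.
rewrite mulnC -[n in (n * _)%N]card_ord.
rewrite (@sum_put _ _ (fun f : {ffun 'I_h -> 'I_n} => f s0) (fun f => update f s0)).
- apply: (@leq_trans (\sum_(f : {ffun 'I_h -> 'I_n}) m)); last first.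
    by rewrite sum_nat_const card_ffun !card_ord.
  apply: leq_sum => f _; apply: leq_trans (le_m (X (Z f [set s | s != s0]))).
  rewrite -sum1_card [leqRHS]big_mkcond; apply: leq_sum => i _; rewrite inE /G.
  have -> : Z (update f s0 i) [set s | s != s0] = Z f [set s | s != s0].
    congr (_ `&` (_ `&` _)); apply: eq_bigcapr => s /= ss0.
    by rewrite ffunE (negPf ss0).
  by rewrite ffunE eqxx; case: ifP.
- by move=> f i; rewrite ffunE eqxx.
- by move=> f; apply/ffunP => s; rewrite !ffunE; case: eqP => [->|].
- by move=> f i i'; apply/ffunP => s; rewrite !ffunE; case: eqP.
Qed.

End FractionalHelly.

(** * From subsets to tuples, and the bound [d + 1] *)

Lemma expn_le_bin n r : (r <= n)%N -> (n ^ r <= r ^ r * 'C(n, r))%N.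
Proof.
move=> rn; rewrite -(@leq_pmul2r r`!) ?fact_gt0 // -mulnA bin_ffact.
have pow a : (a ^ r = \prod_(i < r) a)%N by rewrite prod_nat_const card_ord.
have -> : (r`! = \prod_(i < r) (r - i))%N by rewrite -ffactnn ffact_prod.
rewrite ffact_prod (pow n) (pow r) -!big_split /=; apply: leq_prod => i _.
(* Factor by factor, [n * (r - i) <= r * (n - i)]. *)
by rewrite !mulnBr [(n * r)%N]mulnC leq_sub2l // leq_mul2r rn orbT.
Qed.

Lemma meets_ffun_card (R : realType) d (M : set 'rV[R]_d) n (C : 'I_n -> set 'rV[R]_d) r :
  (0 < n)%N ->
  (#|[pred I : {set 'I_n} | (#|I| == r) && `[< subfamily_meet M C I !=set0 >]]| <=
   #|[pred f : {ffun 'I_r -> 'I_n} | meets M C f]|)%N.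
Proof.
move=> n0; pose im (f : {ffun 'I_r -> 'I_n}) := (f @: [set: 'I_r])%SET.
apply: (@leq_trans #|[set im f | f in
  [pred f : {ffun 'I_r -> 'I_n} | meets M C f]]%SET|); last exact: leq_imset_card.
apply/subset_leq_card/fintype.subsetP => I; rewrite inE => /andP[/eqP cI /asboolP[x [Mx Cx]]].
have f_in s : (s < r)%N -> nth (Ordinal n0) (enum I) s \in I.
  by move=> sr; rewrite -mem_enum mem_nth // -cardE cI.
apply/imsetP; exists [ffun s : 'I_r => nth (Ordinal n0) (enum I) s].
  by rewrite inE /meets; exists x; split=> // s; rewrite ffunE; apply: Cx => /=; exact: f_in.
apply/finset.setP => i; apply/idP/imsetP => [iI|[s _ ->]]; last by rewrite ffunE f_in.
have ir : (index i (enum I) < r)%N by rewrite -cI cardE index_mem mem_enum.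
by exists (Ordinal ir); rewrite // ffunE nth_index // mem_enum.
Qed.

Lemma fractional_helly_dim (R : realType) (d : nat) (M : set 'rV[R]_d) h :
  M !=set0 -> closed M -> helly_property M h -> fractional_helly_property M d.+1.
Proof.
move=> M0 clM hM alpha /andP[alpha0 alpha1].
have h0 := helly_gt0 M0 hM.
pose r := d.+1; pose t' := colored_helly_size h r.
(* [alpha / r ^ r] bounds the density of meeting [r]-tuples among all maps, and [delta] that of the
   blow-ups. The factor [r * t'.+1 ^ h] in [N] comes from the first moment bound, the factor [h]
   from [fractional_helly_count]. *)
pose delta : R := (alpha / (r ^ r)%:R) ^+ (t'.+1 ^ r).
pose N : R := (r * t'.+1 ^ h * h)%:R.
have rr0 : 0 < (r ^ r)%:R :> R by rewrite ltr0n expn_gt0.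
have alphar0 : 0 < alpha / (r ^ r)%:R by rewrite divr_gt0.
have delta0 : 0 < delta by rewrite exprn_gt0.
have N0 : (0 < r * t'.+1 ^ h * h)%N by rewrite !muln_gt0 expn_gt0 h0.
have delta1 : delta <= 1.
  apply: exprn_ile1; first exact: ltW.
  by rewrite ler_pdivrMr // mul1r (le_trans alpha1) // ler1n expn_gt0.
exists (delta / N).
  rewrite divr_gt0 ?ltr0n //= ler_pdivrMr ?ltr0n // mul1r (le_trans delta1) //.
  by rewrite ler1n.
move=> n C rn rcC dense; have n0 : (0 < n)%N by apply: leq_trans rn.
pose count x := #|[pred i : 'I_n | `[< C i x >]]|.
have [x maxx] : exists x, forall y, (count y <= count x)%N.
  have ex_count : exists k, `[< exists x, count x = k >].
    by exists (count 0); apply/asboolP; exists 0.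
  have count_le k : `[< exists x, count x = k >] -> (k <= n)%N.
    by move=> /asboolP[y <-]; rewrite (leq_trans (max_card _)) // card_ord.
  have [_ /asboolP[x <-] maxx] := ex_maxnP ex_count count_le.
  by exists x => y; apply: maxx; apply/asboolP; exists y.
exists x; rewrite mulrAC ler_pdivrMr ?ltr0n //.
have := fractional_helly_count M0 clM hM rcC maxx.
set H := [pred f | meets M C f]; set F := [pred f : {ffun 'I_r -> 'I_n} | meets M C f].
move=> le_H.
have nh : 0 < (n ^ h)%:R :> R by rewrite ltr0n expn_gt0 n0.
suff ge_H : delta * (n ^ h)%:R <= (#|H| * (r * t'.+1 ^ h))%:R.
  rewrite -(ler_pM2l nh) mulrA [_ * delta]mulrC.
  apply: le_trans (ler_wpM2r (ler0n _ n) ge_H) _.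
  rewrite /N -!natrM ler_nat mulnAC; apply: leq_trans (leq_mul le_H (leqnn _)) _.
  by rewrite /count; apply/eq_leq; ring.
(* Too few meeting [h]-tuples would allow a blow-up whose rainbow tuples all meet while no [h]
   entries of one colour do, against [colored_helly]. *)
rewrite leNgt natrM; apply/negP => sparse.
have denseF : alpha / (r ^ r)%:R * (n ^ r)%:R <= #|F|%:R.
  apply: le_trans (le_trans dense _); last by rewrite ler_nat meets_ffun_card.
  rewrite -mulrA ler_pM2l // mulrC ler_pdivrMr // -natrM ler_nat mulnC.
  exact: expn_le_bin.
have [||||w [wF wH]] := @exists_blowup R 'I_r 'I_n t' h F H (alpha / (r ^ r)%:R).
- by rewrite card_ord.
- exact: ltW.
- by rewrite !card_ord.
- by rewrite !card_ord.
have /choice[K KE] : forall i, exists K, convex_set K /\ C i = M `&` K.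
  by move=> i; have [K cK ->] := rcC i; exists K.
have /choice[p pE] : forall b : {ffun 'I_r -> 'I_t'.+1}, exists x, M x /\ forall j, C (w j (b j)) x.
  move=> b; have /asboolP[y [My Cy]] := wF b; exists y; split=> // j.
  by have := Cy j; rewrite ffunE.
have [||||j [Y [injY [y My Ky]]]] :=
    @colored_helly R d M h 'I_t'.+1 p (fun j i => K (w j i)) M0 clM hM.
- by rewrite card_ord.
- by move=> j i; exact: (KE _).1.
- by move=> b; exact: (pE b).1.
- by move=> b j; have := (pE b).2 j; rewrite (KE _).2 => -[].
have := wH j [ffun s => Y s]; rewrite inE => /(_ _)/negP; apply.
  by move=> s s'; rewrite !ffunE => /injY.
by apply/asboolP; exists y; split=> // s; rewrite !ffunE (KE _).2.
Qed.

Theorem theorem1p3 (R : realType) (d : nat) (M : set 'rV[R]_d)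
    (M_neq0 : M !=set0) (M_closed : closed M)
    (helly_fin : (helly_number M < +oo)%E) :
  (fractional_helly_number M <= (d.+1)%:R%:E)%E.
Proof.
have [h hM] : exists h, helly_property M h.
  move: helly_fin; rewrite /helly_number /least_or_infty.
  case: pselect => [[h /asboolP hM] _|//]; first by exists h.
have fM := fractional_helly_dim M_neq0 M_closed hM.
rewrite /fractional_helly_number /least_or_infty.
case: pselect => [exh|]; last by case; exists d.+1; apply/asboolP.
case: ex_minnP => m _ /(_ d.+1); rewrite lee_fin ler_nat; apply.
exact/asboolP.
Qed.
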